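(* Let $S$ be a commutative unital ring, $Q$ a group, $\kappa_Q\colon Q\to\mathrm{Aut}(S)$ an action of $Q$ on $S$ by ring automorphisms, and let $(A,\sigma)$ be a $Q$-normal $S$-algebra. Then the Teichmüller class $[\mathrm e_{(A,\sigma)}]\in \mathrm H^3(Q,\mathrm U(S))$ of $(A,\sigma)$ is zero if and only if, for $I=Q$ (as an index set), the induced $Q$-normal structure $\sigma_I$ on the matrix algebra $\mathrm M_I(A)$ is equivariant.
   Context: $\mathrm U(S)$ is the group of units of $S$, a $Q$-module via $\kappa_Q$. A central $S$-algebra is an algebra whose center equals $S$. For a central $S$-algebra $A$, $\mathrm{Aut}(A)$ is its group of ring automorphisms, $\mathrm U(A)$ its group of units, $\partial\colon \mathrm U(A)\to\mathrm{Aut}(A)$ sends $u$ to $a\mapsto uau^{-1}$, $\mathrm{Out}(A)=\mathrm{Aut}(A)/\partial(\mathrm U(A))$, and restriction to the center gives $\mathrm{res}\colon\mathrm{Out}(A)\to\mathrm{Aut}(S)$. A $Q$-normal structure on $A$ is a homomorphism $\sigma\colon Q\to\mathrm{Out}(A)$ with $\mathrm{res}\circ\sigma=\kappa_Q$; the pair $(A,\sigma)$ is a $Q$-normal $S$-algebra. A $Q$-equivariant structure is a homomorphism $\tau\colon Q\to\mathrm{Aut}(A)$ whose restriction to $S$ is $\kappa_Q$; a $Q$-normal structure is called equivariant if it is the composite of some $Q$-equivariant structure with $\mathrm{Aut}(A)\to\mathrm{Out}(A)$. A crossed module $(C,\Gamma,\partial)$ consists of groups $C,\Gamma$, an action of $\Gamma$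 on $C$ and a $\Gamma$-equivariant homomorphism $\partial\colon C\to\Gamma$ ($\Gamma$ acting on itself by conjugation) with ${}^{\partial b}c=bcb^{-1}$. A crossed 2-fold extension is an exact sequence $0\to M\to C\xrightarrow{\partial}\Gamma\to G\to 1$ with $(C,\Gamma,\partial)$ a crossed module; $M$ is then a $G$-module, and the classes of such extensions (with fixed $M$, $G$) under the equivalence relation generated by morphisms of crossed 2-fold extensions that are the identity on $M$ and $G$ form a group canonically isomorphic to $\mathrm H^3(G,M)$. The Teichmüller complex of $(A,\sigma)$ is the crossed 2-fold extension $0\to\mathrm U(S)\to\mathrm U(A)\to B^\sigma\to Q\to1$, where $B^\sigma=\mathrm{Aut}(A)\times_{\mathrm{Out}(A)}Q$ (fiber product via $\sigma$), $\mathrm U(A)\to B^\sigma$ is $u\mapsto(\partial u,1)$ and $B^\sigma$ acts on $\mathrm U(A)$ through $\mathrm{Aut}(A)$; its class in $\mathrm H^3(Q,\mathrm U(S))$ is the Teichmüller class. For a set $I$, $\mathrm M_I(A)$ is the algebra of $I\times I$ matrices over $A$ (for infinite $I$ interpreted as the endomorphism ring of the free module $\bigoplus_I A^{\mathrm{op}}$); it is a central $S$-algebra, each automorphism of $A$ induces one of $\mathrm M_I(A)$ (entrywise), and hence $\sigma$ induces a $Q$-normal structure $\sigma_I\colon Q\to\mathrm{Out}(\mathrm M_I(A))$. *)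

(* Defs.v *)
From mathcomp Require Import all_boot all_algebra.
From Stdlib Require Import Relations List.
Unset Printing Implicit Defensive.
Import GRing.Theory.
Local Open Scope ring_scope.

Record grp := Grp { car : Type; gmem : car -> Prop;
                    gop : car -> car -> car; gone : car }.

Definition is_grp (G : grp) : Prop :=
  gmem G (gone G) /\
  (forall x y, gmem G x -> gmem G y -> gmem G (gop G x y)) /\
  (forall x y z, gmem G x -> gmem G y -> gmem G z ->
     gop G x (gop G y z) = gop G (gop G x y) z) /\
  (forall x, gmem G x -> gop G (gone G) x = x /\ gop G x (gone G) = x) /\
  (forall x, gmem G x -> exists y, gmem G y /\ gop G x y = gone G /\ gop G y x = gone G).

Definition full_grp (T : Type) (m : T -> T -> T) (e : T) : grp :=
  @Grp T (fun _ => True) m e.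
Arguments full_grp {T}.

Definition ghom (G H : grp) (f : car G -> car H) : Prop :=
  (forall x, gmem G x -> gmem H (f x)) /\
  (forall x y, gmem G x -> gmem G y -> f (gop G x y) = gop H (f x) (f y)).


(* Crossed 2-fold extensions  0 -> M -i-> C -dd-> Gam -p-> G -> 1      *)
Record xext (M G : grp) := XExt {
  xC : grp; xGam : grp;
  xact : car xGam -> car xC -> car xC;
  xdd : car xC -> car xGam;
  xi : car M -> car xC;
  xp : car xGam -> car G }.
Arguments xC {M G} x.
Arguments xGam {M G} x.
Arguments xact {M G} x.
Arguments xdd {M G} x.
Arguments xi {M G} x.
Arguments xp {M G} x.

Definition is_xext {M G : grp} (mact : car G -> car M -> car M)
  (E : xext M G) : Prop :=
  let C := xC E in let Gm := xGam E in
  let act := xact E in let dd := xdd E in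
  let i := xi E in let p := xp E in
  is_grp C /\ is_grp Gm /\
  (forall g, gmem Gm g -> ghom C C (act g)) /\
  (forall g h c, gmem Gm g -> gmem Gm h -> gmem C c ->
     act (gop Gm g h) c = act g (act h c)) /\
  (forall c, gmem C c -> act (gone Gm) c = c) /\
  ghom C Gm dd /\ ghom M C i /\ ghom Gm G p /\
  (* crossed module axioms: dd (g.c) = g dd(c) g^-1 ; dd(b).c = b c b^-1 *)
  (forall g c, gmem Gm g -> gmem C c -> gop Gm (dd (act g c)) g = gop Gm g (dd c)) /\
  (forall b c, gmem C b -> gmem C c -> gop C (act (dd b) c) b = gop C b c) /\
  (forall m m', gmem M m -> gmem M m' -> i m = i m' -> m = m') /\
  (forall c, gmem C c -> (dd c = gone Gm <-> exists m, gmem M m /\ i m = c)) /\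
  (forall g, gmem Gm g -> (p g = gone G <-> exists c, gmem C c /\ dd c = g)) /\
  (forall x, gmem G x -> exists g, gmem Gm g /\ p g = x) /\
  (forall g m, gmem Gm g -> gmem M m -> act g (i m) = i (mact (p g) m)).

Definition xmor {M G : grp} (E E' : xext M G) : Prop :=
  exists (fC : car (xC E) -> car (xC E')) (fG : car (xGam E) -> car (xGam E')),
    ghom (xC E) (xC E') fC /\ ghom (xGam E) (xGam E') fG /\
    (forall m, gmem M m -> fC (xi E m) = xi E' m) /\
    (forall g, gmem (xGam E) g -> xp E' (fG g) = xp E g) /\
    (forall c, gmem (xC E) c -> xdd E' (fC c) = fG (xdd E c)) /\
    (forall g c, gmem (xGam E) g -> gmem (xC E) c ->
       fC (xact E g c) = xact E' (fG g) (fC c)).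

Definition xstep {M G : grp} (mact : car G -> car M -> car M)
  (E E' : xext M G) : Prop :=
  is_xext mact E /\ is_xext mact E' /\ xmor E E'.

Definition xequiv (M G : grp) (mact : car G -> car M -> car M) :
  relation (xext M G) := clos_refl_sym_trans _ (xstep mact).

(* the trivial (split) crossed extension 0 -> M = M -1-> G = G -> 1,
   representing the zero class of H^3(G, M) *)
Definition xtriv (M G : grp) (mact : car G -> car M -> car M) : xext M G :=
  @XExt M G M G mact (fun _ => gone G) id id.

Definition ring_aut {R : pzRingType} (f : R -> R) : Prop :=
  (forall a b, f (a + b) = f a + f b) /\ (forall a b, f (a * b) = f a * f b) /\
  f 1 = 1 /\ bijective f.

Definition ring_mor {R R' : pzRingType} (f : R -> R') : Prop :=
  (forall a b, f (a + b) = f a + f b) /\ (forall a b, f (a * b) = f a * f b) /\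
  f 1 = 1.

Definition central_alg (S : comPzRingType) (A : pzRingType) (iota : S -> A) : Prop :=
  ring_mor iota /\ injective iota /\
  (forall a : A, (forall b, a * b = b * a) <-> exists x, a = iota x).

Definition ring_action (Q : Type) (qmul : Q -> Q -> Q) (q1 : Q)
  (S : comPzRingType) (kappa : Q -> S -> S) : Prop :=
  (forall q, ring_aut (kappa q)) /\
  (forall q r x, kappa (qmul q r) x = kappa q (kappa r x)) /\
  (forall x, kappa q1 x = x).

(* alpha and beta have the same image in Out(A) *)
Definition inner_equiv {A : pzRingType} (f g : A -> A) : Prop :=
  exists u v : A, u * v = 1 /\ v * u = 1 /\ forall a, f a = u * g a * v.

(* A Q-normal structure sigma : Q -> Out(A), given by a choice of
   representatives s q in Aut(A) of sigma q. *)
Definition qnormal (Q : Type) (qmul : Q -> Q -> Q) (S : comPzRingType)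
  (A : pzRingType) (iota : S -> A) (kappa : Q -> S -> S) (s : Q -> A -> A) : Prop :=
  (forall q, ring_aut (s q)) /\
  (forall q r, inner_equiv (s (qmul q r)) (s q \o s r)) /\
  (forall q x, s q (iota x) = iota (kappa q x)).

Definition unit_grp (R : pzRingType) : grp :=
  @Grp (R * R)%type (fun p => p.1 * p.2 = 1 /\ p.2 * p.1 = 1)
       (fun p p' => (p.1 * p'.1, p'.2 * p.2)) (1, 1).

(* B^sigma = Aut(A) x_{Out(A)} Q *)
Definition Bsigma (Q : Type) (qmul : Q -> Q -> Q) (q1 : Q)
  (A : pzRingType) (s : Q -> A -> A) : grp :=
  @Grp ((A -> A) * Q)%type
       (fun g => ring_aut g.1 /\ inner_equiv g.1 (s g.2))
       (fun g h => (g.1 \o h.1, qmul g.2 h.2)) (id, q1).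

Definition teich (Q : Type) (qmul : Q -> Q -> Q) (q1 : Q)
  (S : comPzRingType) (A : pzRingType) (iota : S -> A) (s : Q -> A -> A) :
  xext (unit_grp S) (full_grp qmul q1) :=
  @XExt (unit_grp S) (full_grp qmul q1) (unit_grp A) (Bsigma Q qmul q1 A s)
     (fun g u => (g.1 u.1, g.1 u.2))
     (fun u => ((fun a => u.1 * a * u.2), q1))
     (fun x => (iota x.1, iota x.2))
     (fun g => g.2).

Definition unit_act (Q : Type) (S : comPzRingType) (kappa : Q -> S -> S)
  (q : Q) (x : S * S) : S * S := (kappa q x.1, kappa q x.2).

Definition teich_class_zero (Q : Type) (qmul : Q -> Q -> Q) (q1 : Q)
  (S : comPzRingType) (A : pzRingType) (iota : S -> A) (kappa : Q -> S -> S)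
  (s : Q -> A -> A) : Prop :=
  xequiv (unit_grp S) (full_grp qmul q1) (unit_act Q S kappa)
         (teich Q qmul q1 S A iota s)
         (xtriv (unit_grp S) (full_grp qmul q1) (unit_act Q S kappa)).

(* M_I(A): column-finite I x I matrices over A (= End of the free     *)
(* right A-module on I).  Products are given as a relation since I    *)
(* carries no decidable equality.                                      *)
Section Mx.
Variables (I : Type) (A : pzRingType).
Definition mx := I -> I -> A.

Definition colfin (m : mx) : Prop :=
  forall k, exists l : list I, forall i, m i k <> 0 -> List.In i l.

Definition mxadd (m n : mx) : mx := fun i j => m i j + n i j.

Definition mxmul_rel (m n p : mx) : Prop :=
  forall i k, exists l : list I, List.NoDup l /\
    (forall j, n j k <> 0 -> List.In j l) /\
    p i k = \sum_(j <- l) m i j * n j k.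

Definition mx_scal (c : A) (m : mx) : Prop :=
  forall i j, (i = j -> m i j = c) /\ (i <> j -> m i j = 0).

Definition mx_isone (m : mx) : Prop := mx_scal 1 m.

Definition mx_aut (F : mx -> mx) : Prop :=
  (forall m, colfin m -> colfin (F m)) /\
  (forall m n, colfin m -> colfin n -> F (mxadd m n) = mxadd (F m) (F n)) /\
  (forall m n p, colfin m -> colfin n -> mxmul_rel m n p ->
                 mxmul_rel (F m) (F n) (F p)) /\
  (forall e, mx_isone e -> mx_isone (F e)) /\
  (exists G : mx -> mx, forall m, colfin m ->
      colfin (G m) /\ G (F m) = m /\ F (G m) = m).

(* F and G have the same image in Out(M_I(A)) *)
Definition mx_inner_equiv (F G : mx -> mx) : Prop :=
  exists u v : mx, colfin u /\ colfin v /\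
    (forall e, mx_isone e -> mxmul_rel u v e /\ mxmul_rel v u e) /\
    (forall m, colfin m -> exists t, mxmul_rel u (G m) t /\ mxmul_rel t v (F m)).

Definition mx_map (f : A -> A) (m : mx) : mx := fun i j => f (m i j).
End Mx.
Arguments colfin {I A}.
Arguments mxadd {I A}.
Arguments mxmul_rel {I A}.
Arguments mx_scal {I A}.
Arguments mx_isone {I A}.
Arguments mx_aut {I A}.
Arguments mx_inner_equiv {I A}.
Arguments mx_map {I A}.

(* The induced Q-normal structure sigma_I on M_I(A), I = Q, is
   equivariant: it lifts to a homomorphism tau : Q -> Aut(M_I(A))
   restricting to kappa on the center S. *)
Definition sigmaI_equivariant (Q : Type) (qmul : Q -> Q -> Q) (q1 : Q)
  (S : comPzRingType) (A : pzRingType) (iota : S -> A) (kappa : Q -> S -> S)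
  (s : Q -> A -> A) : Prop :=
  exists tau : Q -> mx Q A -> mx Q A,
    (forall q, mx_aut (tau q)) /\
    (forall q r m, colfin m -> tau (qmul q r) m = tau q (tau r m)) /\
    (forall m, colfin m -> tau q1 m = m) /\
    (forall q x m, mx_scal (iota x) m -> mx_scal (iota (kappa q x)) (tau q m)) /\
    (forall q, mx_inner_equiv (tau q) (mx_map (s q))).

(* Main.v *)
(* Say that a crossed 2-fold extension of Q by M is split when some section
   q |-> g_q of Gam -> Q admits f(q, r) in C with g_q g_r = dd f(q, r) g_(qr)
   and g_q.f(r, t) f(q, rt) = f(q, r) f(qr, t). This property is carried by
   morphisms of extensions in both directions and holds for the trivial
   extension, so it holds for the Teichmueller complex as soon as its class
   vanishes. Conjugating the entrywise action of g_q on M_Q(A) by the monomial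
   matrix with entries f(q, t)^-1 at (qt, t) then gives a homomorphism
   tau : Q -> Aut(M_Q(A)) lifting sigma_Q.
   Conversely, scalar matrices define a morphism from the Teichmueller complex
   of A to that of M_Q(A), and a lift tau of sigma_Q is a morphism from the
   trivial extension to the latter, so the class of A is zero. *)
Require Import Defs.
From HB Require Import structures.
From mathcomp Require Import all_boot all_algebra.
From mathcomp Require Import boolp.
From Stdlib Require Import Relations List Permutation.
Import GRing.Theory.
Local Open Scope ring_scope.

Local Notation "x ∙ y" := (gop _ x y) (at level 40, left associativity).

(** * Crossed extensions and their splittings *)

Section GroupTheory.
Variables (G H : grp) (HG : is_grp G) (HH : is_grp H).

Lemma gmem1 : gmem G (gone G).
Proof. by case: HG. Qed.

Lemma gmemM x y : gmem G x -> gmem G y -> gmem G (x ∙ y).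
Proof. by case: HG => _ [+ _]; apply. Qed.

Lemma gmulA x y z : gmem G x -> gmem G y -> gmem G z -> x ∙ (y ∙ z) = x ∙ y ∙ z.
Proof. by case: HG => _ [_ [+ _]]; apply. Qed.

Lemma gmul1 x : gmem G x -> gone G ∙ x = x.
Proof. by case: HG => _ [_ [_ [h _]]] /h []. Qed.

Lemma gmulr1 x : gmem G x -> x ∙ gone G = x.
Proof. by case: HG => _ [_ [_ [h _]]] /h []. Qed.

Lemma gmulVex x : gmem G x ->
  exists y, gmem G y /\ x ∙ y = gone G /\ y ∙ x = gone G.
Proof. by case: HG => _ [_ [_ [_ h]]] /h. Qed.

Lemma gmulIr z x y : gmem G x -> gmem G y -> gmem G z -> x ∙ z = y ∙ z -> x = y.
Proof.
move=> hx hy hz e; have [w [hw [e1 _]]] := gmulVex z hz.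
by rewrite -(gmulr1 x) // -(gmulr1 y) // -e1 !gmulA // e.
Qed.

(** The image of the neutral element is idempotent, hence neutral in [H]. *)
Lemma ghom1 f : ghom G H f -> f (gone G) = gone H.
Proof.
move=> [fm fM]; have h1 := fm _ gmem1.
have [w [hw [e1 _]]] : exists y, gmem H y /\ f (gone G) ∙ y = gone H /\
    y ∙ f (gone G) = gone H by case: HH => _ [_ [_ [_ h]]]; exact: h.
have e : f (gone G) ∙ f (gone G) = f (gone G).
  by rewrite -fM ?gmul1 //; exact: gmem1.
case: HH => _ [_ [hA [hN _]]].
by rewrite -e1 -{2}e -hA // e1; case: (hN _ h1).
Qed.

End GroupTheory.

Section CrossedExtensions.
Variables (M : grp) (Q : Type) (qmul : Q -> Q -> Q) (q1 : Q).
Hypotheses (HM : is_grp M) (HQ : is_grp (full_grp qmul q1)).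
Variable mact : Q -> car M -> car M.

Local Notation ext := (xext M (full_grp qmul q1)).

Lemma full_grpA q r t : qmul q (qmul r t) = qmul (qmul q r) t.
Proof. exact: (gmulA _ HQ). Qed.

Lemma full_grp1 q : qmul q1 q = q.
Proof. exact: (gmul1 _ HQ). Qed.

Lemma full_grpr1 q : qmul q q1 = q.
Proof. exact: (gmulr1 _ HQ). Qed.

(* The multiplicative 3-cocycle attached to a section [g] of [Gam -> Q] and
   a choice of [f] is trivial; this says that the class of [E] in H^3
   vanishes, without reference to the equivalence relation. *)
Definition split_data (E : ext) (g : Q -> car (xGam E))
    (f : Q -> Q -> car (xC E)) : Prop :=
  (forall q, gmem (xGam E) (g q)) /\ (forall q, xp E (g q) = q) /\
  (forall q r, gmem (xC E) (f q r)) /\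
  (forall q r, g q ∙ g r = xdd E (f q r) ∙ g (qmul q r)) /\
  (forall q r t, xact E (g q) (f r t) ∙ f q (qmul r t) =
                 f q r ∙ f (qmul q r) t).

Definition has_split_data (E : ext) : Prop := exists g f, split_data E g f.

(** * Exactness of a crossed extension and the fibres of its maps *)

Section Kernels.
Variables (E : ext) (HE : @is_xext M (full_grp qmul q1) mact E).

Lemma xC_grp : is_grp (xC E). Proof. by case: HE. Qed.

Lemma xGam_grp : is_grp (xGam E). Proof. by case: HE => _ []. Qed.

Lemma xact_hom g : gmem (xGam E) g -> ghom (xC E) (xC E) (xact E g).
Proof. by case: HE => _ [_ [+ _]]; apply. Qed.

Lemma xactM g h c : gmem (xGam E) g -> gmem (xGam E) h -> gmem (xC E) c ->
  xact E (g ∙ h) c = xact E g (xact E h c).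
Proof. by case: HE => _ [_ [_ [+ _]]]; apply. Qed.

Lemma xdd_hom : ghom (xC E) (xGam E) (xdd E).
Proof. by case: HE => _ [_ [_ [_ [_ []]]]]. Qed.

Lemma xi_hom : ghom M (xC E) (xi E).
Proof. by case: HE => _ [_ [_ [_ [_ [_ []]]]]]. Qed.

Lemma xp_hom : ghom (xGam E) (full_grp qmul q1) (xp E).
Proof. by case: HE => _ [_ [_ [_ [_ [_ [_ []]]]]]]. Qed.

Lemma xdd_act g c : gmem (xGam E) g -> gmem (xC E) c ->
  xdd E (xact E g c) ∙ g = g ∙ xdd E c.
Proof. by case: HE => _ [_ [_ [_ [_ [_ [_ [_ [+ _]]]]]]]]; apply. Qed.

Lemma xact_dd b c : gmem (xC E) b -> gmem (xC E) c ->
  xact E (xdd E b) c ∙ b = b ∙ c.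
Proof. by case: HE => _ [_ [_ [_ [_ [_ [_ [_ [_ [+ _]]]]]]]]]; apply. Qed.

Lemma xi_inj m m' : gmem M m -> gmem M m' -> xi E m = xi E m' -> m = m'.
Proof. by case: HE => _ [_ [_ [_ [_ [_ [_ [_ [_ [_ [+ _]]]]]]]]]]; apply. Qed.

Lemma xdd_ker c : gmem (xC E) c -> xdd E c = gone (xGam E) ->
  exists m, gmem M m /\ xi E m = c.
Proof.
case: HE => _ [_ [_ [_ [_ [_ [_ [_ [_ [_ [_ [h _]]]]]]]]]]] hc.
by case: (h c hc).
Qed.

Lemma xdd_xi m : gmem M m -> xdd E (xi E m) = gone (xGam E).
Proof.
case: HE => _ [_ [_ [_ [_ [_ [hi [_ [_ [_ [_ [h _]]]]]]]]]]] hm.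
by apply/(h _ (proj1 hi _ hm)); exists m.
Qed.

Lemma xp_ker g : gmem (xGam E) g -> xp E g = q1 ->
  exists c, gmem (xC E) c /\ xdd E c = g.
Proof.
case: HE => _ [_ [_ [_ [_ [_ [_ [_ [_ [_ [_ [_ [h _]]]]]]]]]]]] hg.
by case: (h g hg).
Qed.

Lemma xp_surj q : exists g, gmem (xGam E) g /\ xp E g = q.
Proof.
case: HE => _ [_ [_ [_ [_ [_ [_ [_ [_ [_ [_ [_ [_ [h _]]]]]]]]]]]]].
exact: h.
Qed.

(** The quotient [g h^-1] lies in the kernel of [xp E], so exactness at [xGam E] applies. *)
Lemma xp_fiber g h : gmem (xGam E) g -> gmem (xGam E) h -> xp E g = xp E h ->
  exists c, gmem (xC E) c /\ g = xdd E c ∙ h.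
Proof.
move=> hg hh e; have hG := xGam_grp; have [_ pM] := xp_hom.
have [h' [hh' [e1 e2]]] := gmulVex _ hG h hh.
have [||c [hc ec]] := xp_ker (g ∙ h').
- exact: gmemM.
- by rewrite pM // e -pM // e1; exact: (ghom1 _ _ hG HQ _ xp_hom).
by exists c; split=> //; rewrite ec -gmulA // e2 gmulr1.
Qed.

(** The quotient [a b^-1] lies in the kernel of [xdd E], so exactness at [xC E] applies. *)
Lemma xdd_fiber a b : gmem (xC E) a -> gmem (xC E) b -> xdd E a = xdd E b ->
  exists m, gmem M m /\ a = xi E m ∙ b.
Proof.
move=> ha hb e; have hC := xC_grp; have [_ dM] := xdd_hom.
have [b' [hb' [e1 e2]]] := gmulVex _ hC b hb.
have [||m [hm em]] := xdd_ker (a ∙ b').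
- exact: gmemM.
- by rewrite dM // e -dM // e1; exact: (ghom1 _ _ hC xGam_grp _ xdd_hom).
by exists m; split=> //; rewrite em -gmulA // e2 gmulr1.
Qed.

End Kernels.

(** * Transport of split data along morphisms, in both directions *)

Lemma xmor_split_data (E E' : ext) : @is_xext M (full_grp qmul q1) mact E ->
  xmor E E' -> has_split_data E -> has_split_data E'.
Proof.
move=> HE [fC [fG [[Cm CM] [[Gm GM] [_ [Gp [CG Ca]]]]]]].
move=> [g [f [gm [gp [fm [gg cc]]]]]].
have [dm _] := xdd_hom E HE.
have am q r t : gmem (xC E) (xact E (g q) (f r t)).
  by have [h _] := xact_hom E HE _ (gm q); exact: h.
exists (fun q => fG (g q)), (fun q r => fC (f q r)).
split; first by move=> q; exact: Gm.
split; first by move=> q; rewrite Gp.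
split; first by move=> q r; exact: Cm.
by split=> [q r|q r t]; [rewrite CG // -!GM ?gg; auto|rewrite -Ca // -!CM ?cc].
Qed.

(** Passing from the section [g] to [h = dd(c) g] turns [f] into the cochain [k(q, r) = c(q)
    (g_q.c(r)) f(q, r) c(qr)^-1], a nonabelian change by a coboundary. The formula for [k] is
    assumed with the inverse cleared. *)
Lemma split_data_change (E : ext) g f (c : Q -> car (xC E)) h k :
  @is_xext M (full_grp qmul q1) mact E -> split_data E g f ->
  (forall q, gmem (xC E) (c q)) ->
  (forall q, h q = xdd E (c q) ∙ g q) ->
  (forall q r, gmem (xC E) (k q r)) ->
  (forall q r, k q r ∙ c (qmul q r) = c q ∙ xact E (g q) (c r) ∙ f q r) ->
  forall q r t, xact E (h q) (k r t) ∙ k q (qmul r t) = k q r ∙ k (qmul q r) t.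
Proof.
move=> HE [gm [gp [fm [gg cc]]]] cm eh km ek q r t.
have hC := xC_grp E HE; have hG := xGam_grp E HE.
have mM := gmemM _ hC; have A := gmulA _ hC.
have [dm dM] := xdd_hom E HE.
have am g0 c0 : gmem (xGam E) g0 -> gmem (xC E) c0 -> gmem (xC E) (xact E g0 c0).
  by move=> /(xact_hom E HE)[+ _]; apply.
have aM g0 c0 c1 : gmem (xGam E) g0 -> gmem (xC E) c0 -> gmem (xC E) c1 ->
    xact E g0 (c0 ∙ c1) = xact E g0 c0 ∙ xact E g0 c1.
  by move=> /(xact_hom E HE)[_ +]; apply.
have hm x : gmem (xGam E) (h x) by rewrite eh; apply: gmemM; auto.
(* Multiplied by [c(qrt)] on the right, both sides reduce to [c(q) (g_q.c(r)) f(q, r) (g_qr.c(t))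
   f(qr, t)]. *)
apply: (gmulIr _ hC (c (qmul q (qmul r t)))); auto 6.
have -> : xact E (h q) (k r t) ∙ k q (qmul r t) ∙ c (qmul q (qmul r t)) =
    c q ∙ xact E (g q) (k r t ∙ c (qmul r t)) ∙ f q (qmul r t).
  rewrite -A; auto 6; rewrite ek eh xactM; auto.
  by rewrite !A; auto 8; rewrite xact_dd; auto 8; rewrite -[c q ∙ _ ∙ _]A; auto 8;
     rewrite -aM; auto.
rewrite full_grpA -[RHS]A; auto 6; rewrite !ek.
rewrite [RHS]A; auto 8; rewrite [k q r ∙ _]A; auto 8; rewrite ek.
rewrite !aM; auto 8.
rewrite -(xactM E HE); auto; rewrite gg xactM; auto.
rewrite -!A; auto 10; rewrite cc.
congr (_ ∙ (_ ∙ _)).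
(* The Peiffer identity moves [f(q, r)] past [g_qr.c(t)]. *)
by rewrite !A; auto 8; rewrite xact_dd; auto 8.
Qed.

(* [fC] is injective on each fibre of [dd], both fibres being torsors
   under [M]; so the trivialisation of [E'], moved to a section coming from
   [E], lifts uniquely. *)
Lemma xmor_split_data_back (E E' : ext) :
  @is_xext M (full_grp qmul q1) mact E -> @is_xext M (full_grp qmul q1) mact E' ->
  xmor E E' -> has_split_data E' -> has_split_data E.
Proof.
move=> HE HE' [fC [fG [[Cm CM] [[Gm GM] [Ci [Gp [CG Ca]]]]]]].
move=> [g [f sd]]; have [gm [gp [fm [gg cc]]]] := sd.
have hC := xC_grp E HE; have hG := xGam_grp E HE.
have hC' := xC_grp E' HE'; have hG' := xGam_grp E' HE'.
have [dm dM] := xdd_hom E HE; have [dm' dM'] := xdd_hom E' HE'.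
have [im iM] := xi_hom E HE; have [im' iM'] := xi_hom E' HE'.
have am g0 c0 : gmem (xGam E) g0 -> gmem (xC E) c0 -> gmem (xC E) (xact E g0 c0).
  by move=> /(xact_hom E HE)[+ _]; apply.
have am' g0 c0 : gmem (xGam E') g0 -> gmem (xC E') c0 ->
    gmem (xC E') (xact E' g0 c0).
  by move=> /(xact_hom E' HE')[+ _]; apply.
have mC := gmemM _ hC; have mG := gmemM _ hG.
have mC' := gmemM _ hC'; have mG' := gmemM _ hG'.
have AG := gmulA _ hG; have AG' := gmulA _ hG'; have AC' := gmulA _ hC'.
have [y hy] := choice (xp_surj E HE).
have ym q : gmem (xGam E) (y q) by case: (hy q).
have yp q : xp E (y q) = q by case: (hy q).
(* [c] measures how far the image under [fG] of the section [y] of [E] is from the given section [g]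
   of [E']. *)
have /choice[c hc] q : exists c, gmem (xC E') c /\ fG (y q) = xdd E' c ∙ g q.
  by apply: xp_fiber; auto; rewrite Gp // yp gp.
have cm q : gmem (xC E') (c q) by case: (hc q).
have ce q : fG (y q) = xdd E' (c q) ∙ g q by case: (hc q).
(* The cochain belonging to the section [fG (y q)], still multiplied by [c(qr)] on the right. *)
pose F q r := c q ∙ xact E' (g q) (c r) ∙ f q r.
have Fm q r : gmem (xC E') (F q r) by rewrite /F; auto 6.
have ex (z : Q * Q) : exists x, gmem (xC E) x /\
    y z.1 ∙ y z.2 = xdd E x ∙ y (qmul z.1 z.2) /\
    fC x ∙ c (qmul z.1 z.2) = F z.1 z.2.
  case: z => q r /=.
  (* An [x] with the right boundary has the right image under [fC] up to some [m] in [M];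
     multiplying [x] by [xi E m] corrects the image and keeps the boundary. *)
  have [|||x [xm xe]] := xp_fiber E HE (y q ∙ y r) (y (qmul q r)); auto 6.
    by have [_ ->] := xp_hom E HE; rewrite ?yp.
  have [|||m [mm me]] := xdd_fiber E' HE' (F q r) (fC x ∙ c (qmul q r)); auto 6.
    apply: (gmulIr _ hG' (g (qmul q r))); auto.
    rewrite !dM'; auto; rewrite -[RHS]AG'; auto; rewrite -ce CG // -GM; auto.
    rewrite -xe GM // !ce -AG' -?gg; auto.
    rewrite -!AG'; auto; congr (_ ∙ _); rewrite !AG'; auto; congr (_ ∙ _).
    by rewrite xdd_act.
  exists (xi E m ∙ x); split; first by auto.
  split; last by rewrite CM; auto; rewrite Ci // -AC'; auto.
  rewrite dM; auto; rewrite xdd_xi // gmul1; auto.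
have [k hk] := choice ex.
have km q r : gmem (xC E) (k (q, r)) by case: (hk (q, r)).
have ky q r : y q ∙ y r = xdd E (k (q, r)) ∙ y (qmul q r).
  by case: (hk (q, r)) => _ [].
have kF q r : fC (k (q, r)) ∙ c (qmul q r) = F q r.
  by case: (hk (q, r)) => _ [].
exists y, (fun q r => k (q, r)); do !split=> //; move=> q r t.
(* The two sides of the cocycle identity for [k] have the same boundary, so they differ by some [m]
   in [M]; their images under [fC] agree, which forces [m] to be neutral. *)
set L := (X in X = _); set R := (X in _ = X).
have Lm : gmem (xC E) L by apply: mC; auto.
have Rm : gmem (xC E) R by apply: mC; auto.
have eL : xdd E L = xdd E R.
  apply: (gmulIr _ hG (y (qmul q (qmul r t)))); auto.
  rewrite /L /R !dM; auto.
  rewrite -AG; auto; rewrite -ky AG; auto; rewrite xdd_act; auto.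
  rewrite -AG; auto; rewrite -ky full_grpA -[RHS]AG; auto.
  by rewrite -ky AG; auto; rewrite ky AG; auto.
have [m [mm eLR]] := xdd_fiber E HE L R Lm Rm eL.
have eC : fC L = fC R.
  rewrite !CM ?Ca; auto.
  by apply: (split_data_change E' g f c (fun q => fG (y q))
              (fun q r => fC (k (q, r)))); auto.
have im1 : xi E' m = gone (xC E').
  apply: (gmulIr _ hC' (fC R)); auto; first exact: gmem1.
  by rewrite -Ci // -CM; auto; rewrite -eLR gmul1; auto.
have -> : L = xi E (gone M) ∙ R.
  rewrite eLR; congr (xi E _ ∙ _); apply: (xi_inj E' HE') => //.
    exact: gmem1.
  by rewrite im1; symmetry; exact: (ghom1 _ _ HM hC' _ (xi_hom E' HE')).
by rewrite (ghom1 _ _ HM hC _ (xi_hom E HE)) gmul1.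
Qed.

Lemma xequiv_split_data (E E' : ext) :
  xequiv M (full_grp qmul q1) mact E E' -> has_split_data E <-> has_split_data E'.
Proof.
elim=> [{}E {}E' [hE [hE' hm]]|//|{}E {}E' _ IH|E1 E2 E3 _ IH1 _ IH2].
- by split; [apply: xmor_split_data|apply: xmor_split_data_back].
- by split=> /IH.
- by split=> [/IH1 /IH2|/IH2 /IH1].
Qed.

(** The identity of [Q] is a homomorphic section, so the constant neutral cochain works. *)
Lemma xtriv_split_data (E := xtriv M (full_grp qmul q1) mact) :
  @is_xext M (full_grp qmul q1) mact E -> has_split_data E.
Proof.
move=> HE; have m1 := gmem1 _ HM.
exists id, (fun _ _ => gone M); do 4!split=> //=; move=> q r.
  by rewrite full_grp1.
move=> t; have /= h := ghom1 _ _ HM HM _ (xact_hom E HE q Logic.I).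
by rewrite h.
Qed.

End CrossedExtensions.
(** * The Teichmueller complex as a crossed extension *)

Section InnerEquivalence.
Variable A : pzRingType.
Implicit Types f g h : A -> A.

Lemma ring_aut0 f : ring_aut f -> f 0 = 0.
Proof. by move=> [fD _]; apply: (addrI (f 0)); rewrite -fD !addr0. Qed.

Lemma ring_aut_id : ring_aut (@id A).
Proof. by do !split=> //; exists id. Qed.

Lemma ring_aut_comp f g : ring_aut f -> ring_aut g -> ring_aut (f \o g).
Proof.
move=> [fD [fM [f1 fb]]] [gD [gM [g1 gb]]]; split; [move=> a b|split; [move=> a b|split]]; rewrite /=.
- by rewrite gD fD.
- by rewrite gM fM.
- by rewrite g1.
- exact: bij_comp.
Qed.

Lemma ring_aut_inv f g : cancel f g -> cancel g f -> ring_aut f -> ring_aut g.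
Proof.
move=> fK gK [fD [fM [f1 fb]]]; split; [move=> a b|split; [move=> a b|split]].
- by apply: (can_inj fK); rewrite fD !gK.
- by apply: (can_inj fK); rewrite fM !gK.
- by rewrite -f1 fK.
- by exists f.
Qed.

Lemma ring_aut_conj (u v : A) : u * v = 1 -> v * u = 1 ->
  ring_aut (fun a => u * a * v).
Proof.
move=> uv vu; split; [move=> a b|split; [move=> a b|split]].
- by rewrite mulrDr mulrDl.
- by rewrite !mulrA -[u * a * v * u]mulrA vu mulr1.
- by rewrite mulr1.
- by exists (fun a => v * a * u) => a; rewrite !mulrA ?uv ?vu mul1r -mulrA
    ?uv ?vu mulr1.
Qed.

Lemma inner_equiv_refl f : inner_equiv f f.
Proof. by exists 1, 1; rewrite mulr1; split=> //; split=> // a; rewrite mul1r mulr1. Qed.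

Lemma inner_equiv_sym f g : inner_equiv f g -> inner_equiv g f.
Proof.
move=> [u [v [uv [vu e]]]]; exists v, u; split=> //; split=> // a.
by rewrite e !mulrA vu mul1r -mulrA vu mulr1.
Qed.

Lemma inner_equiv_trans f g h :
  inner_equiv f g -> inner_equiv g h -> inner_equiv f h.
Proof.
move=> [u [v [uv [vu e]]]] [u' [v' [uv' [vu' e']]]].
exists (u * u'), (v' * v); split; last split; last by move=> a; rewrite e e' !mulrA.
- by rewrite mulrA -(mulrA u) uv' mulr1.
- by rewrite mulrA -(mulrA v') vu mulr1.
Qed.

(** An automorphism [f] carries conjugation by [u] to conjugation by [f u], so composition descends
    to [Out(A)]. *)
Lemma inner_equiv_comp f f' g g' : ring_aut f ->
  inner_equiv f f' -> inner_equiv g g' -> inner_equiv (f \o g) (f' \o g').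
Proof.
move=> [_ [fM [f1 _]]] ff' [u [v [uv [vu e]]]].
apply: (@inner_equiv_trans _ (f \o g')).
  exists (f u), (f v); rewrite -!fM uv vu f1; split=> //; split=> // a.
  by rewrite /= e !fM.
case: ff' => u' [v' [uv' [vu' e']]].
by exists u', v'; split=> //; split=> // a; rewrite /= e'.
Qed.

End InnerEquivalence.

Lemma unit_grpP (R : pzRingType) : is_grp (unit_grp R).
Proof.
split; first by rewrite /= mulr1.
split=> [[u v] [u' v'] /= [uv vu] [uv' vu']|].
  by rewrite mulrA -(mulrA u) uv' mulr1 uv mulrA -(mulrA v') vu mulr1 vu'.
split=> [[u v] [u' v'] [u'' v''] _ _ _|]; first by rewrite /= !mulrA.
split=> [[u v] _|[u v] [uv vu]]; first by rewrite /= !mul1r !mulr1.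
by exists (v, u); rewrite /= in uv vu *; rewrite uv vu.
Qed.

Section TeichmullerComplex.
Variables (Q : Type) (qmul : Q -> Q -> Q) (q1 : Q).
Hypothesis HQ : is_grp (full_grp qmul q1).
Variables (S : comPzRingType) (kappa : Q -> S -> S).
Hypothesis Hkappa : ring_action Q qmul q1 S kappa.

Lemma unit_act_hom q : ghom (unit_grp S) (unit_grp S) (unit_act Q S kappa q).
Proof.
case: Hkappa => /(_ q)[_ [kM [k1 _]]] _.
by split=> [[x y] [/= e e']|[x y] [x' y'] _ _] /=; rewrite /unit_act /= -!kM ?e ?e' ?k1.
Qed.

Lemma xtriv_xext : @is_xext (unit_grp S) (full_grp qmul q1) (unit_act Q S kappa)
  (xtriv (unit_grp S) (full_grp qmul q1) (unit_act Q S kappa)).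
Proof.
have [_ [kA k1]] := Hkappa.
split; first exact: unit_grpP.
split; first by [].
split; first by move=> q _; exact: unit_act_hom.
split; first by move=> q r c _ _ _; rewrite /= /unit_act !kA.
split; first by move=> [x y] _; rewrite /= /unit_act !k1.
split; first by split=> //= x y _ _; rewrite (full_grp1 _ _ _ HQ).
split; first by [].
split; first by [].
split; first by move=> q c _ _ /=; rewrite (full_grp1 _ _ _ HQ) (full_grpr1 _ _ _ HQ).
split.
  move=> [x y] [x' y'] _ _ /=.
  by rewrite /unit_act !k1 mulrC [y * _]mulrC.
split; first by [].
split; first by move=> c hc; split=> // _; exists c.
split; first by move=> q _; split=> [/= ->|[c []]//]; exists (1, 1); rewrite /= mulr1.
split; first by move=> q _; exists q.
by [].
Qed.

Variables (A : pzRingType) (iota : S -> A) (s : Q -> A -> A).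
Hypothesis HA : central_alg S A iota.
Hypothesis Hs : qnormal Q qmul S A iota kappa s.

(** The class of [s q1] is idempotent in the group [Out(A)]. *)
Lemma qnormal_one : inner_equiv (s q1) id.
Proof.
case: Hs => [sa [sM _]]; have := sM q1 q1.
have -> : qmul q1 q1 = q1 by exact: (full_grp1 _ _ _ HQ).
have [sD [smul [s1 [t sK tK]]]] := sa q1.
move=> [u [v [uv [vu e]]]]; apply: inner_equiv_sym; exists u, v; split=> //; split=> // a.
(* [t] inverts [s q1], and evaluating [e] at [t a] cancels one factor [s q1]. *)
by rewrite -{1}(tK a) e /= tK.
Qed.

Lemma Bsigma_grp : is_grp (Bsigma Q qmul q1 A s).
Proof.
have [sa [sM sk]] := Hs.
split; first by split; [exact: ring_aut_id|exact/inner_equiv_sym/qnormal_one].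
split.
  move=> [f q] [g r] [/= fa fq] [/= ga gr]; split=> /=; first exact: ring_aut_comp.
  apply: inner_equiv_trans (inner_equiv_sym _ _ _ (sM q r)).
  exact: inner_equiv_comp.
split; first by move=> [f q] [g r] [h t] _ _ _; congr (_, _); exact: (gmulA _ HQ).
split; first by move=> [f q] _; split; congr (_, _);
  [exact: (full_grp1 _ _ _ HQ)|exact: (full_grpr1 _ _ _ HQ)].
move=> [f q] [/= fa fq].
have [r [_ [qr rq]]] := gmulVex _ HQ q Logic.I; rewrite /= in r qr rq.
have [_ [_ [_ [g fK gK]]]] := fa.
have ga := ring_aut_inv _ _ _ fK gK fa.
exists (g, r); split; last by split; congr (_, _) => //; apply: funext => a /=;
  rewrite ?fK ?gK.
split=> //=; have gf : g \o f = id by apply: funext => a /=; rewrite fK.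
(* In [Out(A)] one has [g = g s_q s_r = g f s_r = s_r]. *)
rewrite -[s r]/(id \o s r) -gf.
have h1 : inner_equiv (s q \o s r) id.
  apply: inner_equiv_trans (inner_equiv_sym _ _ _ (sM q r)) _.
  by rewrite qr; exact: qnormal_one.
apply: (@inner_equiv_trans _ _ (g \o (s q \o s r))).
  by apply: (@inner_equiv_comp _ g g id) => //; [exact: inner_equiv_refl|
     exact: inner_equiv_sym].
apply: (@inner_equiv_comp _ (g \o s q) (g \o f) (s r) (s r)).
- exact: ring_aut_comp.
- by apply: inner_equiv_comp; [|exact: inner_equiv_refl|exact: inner_equiv_sym].
- exact: inner_equiv_refl.
Qed.

Lemma teich_xext :
  @is_xext (unit_grp S) (full_grp qmul q1) (unit_act Q S kappa) (teich Q qmul q1 S A iota s).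
Proof.
have [sa [sM sk]] := Hs; have [kaut [kA k1]] := Hkappa.
have [[iD [iM i1]] [iI iZ]] := HA.
split; first exact: unit_grpP.
split; first exact: Bsigma_grp.
split.
  move=> [f q] [/= [fD [fM [f1 fb]]] fq].
  split=> [[u v] [/= uv vu]|[u v] [u' v'] _ _] /=; first by rewrite -!fM uv vu.
  by rewrite !fM.
split; first by [].
split; first by case.
split.
  split=> [[u v] [/= uv vu]|[u v] [u' v'] _ _] /=; last first.
    congr (_, _); last by rewrite (full_grp1 _ _ _ HQ).
    by apply: funext => a /=; rewrite !mulrA.
  split; first exact: ring_aut_conj.
  apply: inner_equiv_trans (inner_equiv_sym _ _ _ qnormal_one).
  by exists u, v.
split.
  by split=> [[x y] [/= xy yx]|[x y] [x' y'] _ _] /=; rewrite -?iM ?xy ?yx.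
split; first by [].
split.
  move=> [f q] [u v] [/= [fD [fM [f1 fb]]] fq] [/= uv vu].
  congr (_, _); last by rewrite (full_grp1 _ _ _ HQ) (full_grpr1 _ _ _ HQ).
  by apply: funext => a /=; rewrite !fM.
split.
  move=> [u v] [u' v'] [/= uv vu] _ /=.
  by rewrite -!mulrA vu mulr1 !mulrA vu mul1r.
split; first by move=> [x y] [x' y'] _ _ /= [/iI -> /iI ->].
split.
  move=> [u v] [/= uv vu]; split=> [[/funeqP e]|[[x y] [_ [ex _]]]]; last first.
    have [_ cu] := iZ u; congr (_, _); apply: funext => a.
    by rewrite cu -?mulrA ?uv ?mulr1 //; exists x.
  (* Trivial conjugation makes [u] and its inverse [v] central, so both come from [S]; injectivity
     of [iota] makes their preimages mutually inverse. *)
  have cu b : u * b = b * u by rewrite -[in RHS](e b) -mulrA vu mulr1.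
  have cv b : v * b = b * v by rewrite -[in LHS](e b) !mulrA vu mul1r.
  have [x ex] := (proj1 (iZ u)) cu; have [y ey] := (proj1 (iZ v)) cv.
  exists (x, y); rewrite /= -ex -ey; do !split=> //; apply: iI;
    by rewrite iM -ex -ey i1.
split.
  move=> [f q] [/= fa fq]; split=> [eq|[[u v] [_ [_ ->]]]//].
  rewrite /= in eq; subst q; have [u [v [uv [vu e]]]] := inner_equiv_trans _ _ _ _ fq qnormal_one.
  by exists (u, v); do !split=> //; congr (_, _); apply: funext => a; rewrite e.
split; first by move=> q _; exists (s q, q); do !split=> //=; exact: inner_equiv_refl.
move=> [f q] [x y] [/= fa [u [v [uv [vu e]]]]] _ /=.
(* Inner automorphisms fix the centre, so [f] acts on it as [s q] does. *)
have h z : f (iota z) = iota (kappa q z).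
  rewrite e sk; have [_ c] := iZ (iota (kappa q z)).
  by rewrite -c ?uv ?mulr1 -?mulrA ?uv ?mulr1 //; exists (kappa q z).
by rewrite !h.
Qed.

End TeichmullerComplex.

(** * The ring of column-finite matrices *)

Section ListSums.
Variables (I : Type) (A : nmodType).
Implicit Types (l : list I) (F : I -> A).

Lemma eq_sum_In l F G : (forall i, In i l -> F i = G i) ->
  \sum_(i <- l) F i = \sum_(i <- l) G i.
Proof.
elim: l => [|x l IH] e; first by rewrite !big_nil.
by rewrite !big_cons e ?IH; [|move=> i hi; apply: e; right|left].
Qed.

Lemma sum_Permutation l l' F : Permutation l l' ->
  \sum_(i <- l) F i = \sum_(i <- l') F i.
Proof.
elim=> [//|x {}l {}l' _ IH|x y {}l|l1 l2 l3 _ -> _ //].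
- by rewrite !big_cons IH.
- by rewrite !big_cons addrCA.
Qed.

(** Restricted to the support of [F], the two lists become permutations of one another. This makes
    matrix products independent of the list chosen in [mxmul_rel]. *)
Lemma sum_cover l l' F : NoDup l -> NoDup l' ->
  (forall i, F i <> 0 -> In i l) -> (forall i, F i <> 0 -> In i l') ->
  \sum_(i <- l) F i = \sum_(i <- l') F i.
Proof.
move=> ul ul' cl cl'.
have sumE (r : list I) : \sum_(i <- r) F i = \sum_(i <- List.filter (fun i => F i != 0) r) F i.
  elim: r => //= x r IH; rewrite big_cons IH.
  by case: eqP => [->|_] /=; rewrite ?add0r // big_cons.
rewrite sumE [RHS]sumE; apply: sum_Permutation; apply: NoDup_Permutation.
- exact: List.NoDup_filter.
- exact: List.NoDup_filter.
by move=> i; rewrite !filter_In; split=> -[_ /eqP h]; split; auto; apply/eqP.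
Qed.

Lemma sum_single l j0 F : (forall j, j <> j0 -> F j = 0) -> NoDup l ->
  (forall i, F i <> 0 -> In i l) -> \sum_(i <- l) F i = F j0.
Proof.
move=> F0 ul cl; rewrite (sum_cover l (j0 :: nil)) // ?big_seq1 //.
- by constructor; [case|constructor].
- by move=> i hi; left; apply: contrapT => h; apply: hi; apply: F0 => e; apply: h.
Qed.

End ListSums.

(** * Column-finite matrices and their operations *)

Section ColumnFiniteMatrices.
Variables (I : Type) (A : pzRingType).

(** Bundling the finiteness proof yields a type that carries an honest ring structure, to which the
    results on central algebras apply. *)
Record colmx := ColMx { cmval :> I -> I -> A; cmvalP : colfin cmval }.
Implicit Types m n p : colmx.

Lemma colmxP m n : (forall i j, m i j = n i j) -> m = n.
Proof.
case: m n => [m hm] [n hn] /= e.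
have {}e : m = n by apply: funext => i; apply: funext => j.
by case: n / e hn => hn; congr ColMx; exact: Prop_irrelevance.
Qed.

Lemma colfin_NoDup (m : mx I A) k : colfin m ->
  exists l, NoDup l /\ forall i, m i k <> 0 -> In i l.
Proof.
move=> /(_ k)[l hl].
exists (nodup (fun x y : I => pselect (x = y)) l); split; first exact: NoDup_nodup.
by move=> i /hl; rewrite nodup_In.
Qed.

(** A chosen list covering the support of column [k]; it may also contain indices of zero
    entries. *)
Definition colsupp m k : list I := sval (cid (colfin_NoDup m k (cmvalP m))).

Lemma NoDup_colsupp m k : NoDup (colsupp m k).
Proof. by rewrite /colsupp; case: cid => l []. Qed.

Lemma In_colsupp m k i : m i k <> 0 -> In i (colsupp m k).
Proof. by rewrite /colsupp; case: cid => l [] /= _; apply. Qed.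

Lemma colfin_le (m : mx I A) (r : I -> list I) :
  (forall i k, m i k <> 0 -> In i (r k)) -> colfin m.
Proof. by move=> h k; exists (r k) => i; exact: h. Qed.

Definition colmx_add m n : colmx.
Proof.
exists (mxadd m n); apply: (colfin_le _ (fun k => app (colsupp m k) (colsupp n k))).
move=> i k; rewrite /mxadd in_app_iff => h.
have [e|/In_colsupp] := pselect (m i k = 0); last by left.
by right; apply: In_colsupp; rewrite e add0r in h.
Defined.

Definition colmx_opp m : colmx.
Proof.
exists (fun i j => - m i j); apply: (colfin_le _ (colsupp m)) => i k h.
by apply: In_colsupp => e; apply: h; rewrite e oppr0.
Defined.

(* Column [j] has the single entry [c j], in row [sg j]. *)
Definition monmx (sg : I -> I) (c : I -> A) : colmx.
Proof.
exists (fun i j => if `[< i = sg j >] then c j else 0).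
apply: (colfin_le _ (fun k => sg k :: nil)) => i k.
by case: asboolP => // -> _; left.
Defined.

Definition scalmx (c : A) : colmx := monmx id (fun=> c).

Definition colmx_zero : colmx := scalmx 0.

(** Column [k] of the product is supported on the union of the supports of the columns [j] of [m],
    for [j] in the finite list covering column [k] of [n]. *)
Lemma mxmul_colfin m n :
  colfin (fun i k => \sum_(j <- colsupp n k) m i j * n j k).
Proof.
apply: (colfin_le _ (fun k => flat_map (colsupp m) (colsupp n k))) => i k h.
rewrite in_flat_map; apply: contrapT => nex; apply: h.
rewrite (eq_sum_In _ _ _ _ (fun=> 0)) ?big1 // => j hj.
have [->|/In_colsupp h] := pselect (m i j = 0); first by rewrite mul0r.
by case: nex; exists j.
Qed.

Definition colmx_mul m n : colmx := ColMx _ (mxmul_colfin m n).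

Lemma colmx_mulE m n i k l : NoDup l -> (forall j, n j k <> 0 -> In j l) ->
  colmx_mul m n i k = \sum_(j <- l) m i j * n j k.
Proof.
move=> ul cl; apply: sum_cover => //; first exact: NoDup_colsupp.
- by move=> j h; apply: In_colsupp => e; apply: h; rewrite e mulr0.
- by move=> j h; apply: cl => e; apply: h; rewrite e mulr0.
Qed.

Lemma colmx_mul_single j0 m n i k : (forall j, j <> j0 -> m i j * n j k = 0) ->
  colmx_mul m n i k = m i j0 * n j0 k.
Proof.
move=> h; apply: (sum_single _ _ _ j0) => //; first exact: NoDup_colsupp.
by move=> j hj; apply: In_colsupp => e; apply: hj; rewrite e mulr0.
Qed.

Lemma mxmul_relP m n (p : mx I A) : mxmul_rel m n p <-> p = colmx_mul m n.
Proof.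
split=> [h|-> i k].
  apply: funext => i; apply: funext => k; have [l [ul [cl ->]]] := h i k.
  by rewrite (colmx_mulE _ _ _ _ l).
exists (colsupp n k); split; first exact: NoDup_colsupp.
by split=> // j; exact: In_colsupp.
Qed.

Lemma colmx_addE m n i k : colmx_add m n i k = m i k + n i k.
Proof. by []. Qed.

Lemma colmx_zeroE i k : colmx_zero i k = 0.
Proof. by rewrite /=; case: asboolP. Qed.

(** * Ring axioms *)

HB.instance Definition _ := gen_eqMixin colmx.
HB.instance Definition _ := gen_choiceMixin colmx.

Fact colmx_addA : associative colmx_add.
Proof. by move=> m n p; apply: colmxP => i j; rewrite !colmx_addE addrA. Qed.

Fact colmx_addC : commutative colmx_add.
Proof. by move=> m n; apply: colmxP => i j; rewrite !colmx_addE addrC. Qed.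

Fact colmx_add0 : left_id colmx_zero colmx_add.
Proof. by move=> m; apply: colmxP => i j; rewrite !colmx_addE colmx_zeroE add0r. Qed.

Fact colmx_addN : left_inverse colmx_zero colmx_opp colmx_add.
Proof. by move=> m; apply: colmxP => i j; rewrite colmx_addE colmx_zeroE /= addNr. Qed.

HB.instance Definition _ := GRing.isZmodule.Build colmx
  colmx_addA colmx_addC colmx_add0 colmx_addN.

Lemma mul_monmxr m sg c i k : colmx_mul m (monmx sg c) i k = m i (sg k) * c k.
Proof.
rewrite (colmx_mul_single (sg k)) /=; first by case: asboolP.
by move=> j hj; case: asboolP => // _; rewrite mulr0.
Qed.

Lemma mul_scalmxl c m i k : colmx_mul (scalmx c) m i k = c * m i k.
Proof.
rewrite (colmx_mul_single i) /=; first by case: asboolP.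
by move=> j hj; case: asboolP => [e|_]; [case: hj|rewrite mul0r].
Qed.

Fact colmx_mulA : associative colmx_mul.
Proof.
move=> m n p; apply: colmxP => i k.
pose l := colsupp p k.
(* [L] covers column [j] of [n] for every [j] in [l], so a single list serves all inner sums and the
   two summations can be exchanged. *)
pose L := nodup (fun x y : I => pselect (x = y)) (flat_map (colsupp n) l).
have uL : NoDup L by exact: NoDup_nodup.
have cL j h : In j l -> n h j <> 0 -> In h L.
  by move=> hj /In_colsupp hh; apply/nodup_In/in_flat_map; exists j.
rewrite (colmx_mulE _ _ _ _ L) //; last first.
  move=> h; apply: contra_notP => hL /=.
  rewrite (eq_sum_In _ _ _ _ (fun=> 0)) ?big1 // => j hj.
  have [->|/(cL _ _ hj)//] := pselect (n h j = 0); by rewrite mul0r.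
under eq_bigr => h _ do rewrite /= big_distrr /=.
rewrite exchange_big /=; apply: eq_sum_In => j hj.
rewrite -[X in _ = X * _]/(colmx_mul m n i j) (colmx_mulE _ _ _ _ L) //; last first.
  by move=> h; exact: cL.
by rewrite big_distrl /=; apply: eq_bigr => h _; rewrite mulrA.
Qed.

Fact colmx_mul1 : left_id (scalmx 1) colmx_mul.
Proof. by move=> m; apply: colmxP => i k; rewrite mul_scalmxl mul1r. Qed.

Fact colmx_mulr1 : right_id (scalmx 1) colmx_mul.
Proof. by move=> m; apply: colmxP => i k; rewrite mul_monmxr mulr1. Qed.

Fact colmx_mulDl : left_distributive colmx_mul colmx_add.
Proof.
move=> m n p; apply: colmxP => i k; rewrite colmx_addE /= -big_split /=.
by apply: eq_bigr => j _; rewrite -mulrDl.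
Qed.

Fact colmx_mulDr : right_distributive colmx_mul colmx_add.
Proof.
move=> m n p; apply: colmxP => i k; rewrite colmx_addE.
(* One list covering column [k] of [n], of [p] and of their sum. *)
pose l := nodup (fun x y : I => pselect (x = y)) (colsupp n k ++ colsupp p k).
have ul : NoDup l by exact: NoDup_nodup.
have cn j : n j k <> 0 -> In j l.
  by move=> /In_colsupp h; apply/nodup_In/in_app_iff; left.
have cp j : p j k <> 0 -> In j l.
  by move=> /In_colsupp h; apply/nodup_In/in_app_iff; right.
rewrite !(colmx_mulE _ _ _ _ l) //; last first.
  move=> j; rewrite colmx_addE => h.
  have [e|/cn//] := pselect (n j k = 0).
  by apply: cp; rewrite e add0r in h.
by rewrite -big_split /=; apply: eq_bigr => j _; rewrite -mulrDr.
Qed.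

HB.instance Definition _ := GRing.Zmodule_isPzRing.Build colmx
  colmx_mulA colmx_mul1 colmx_mulr1 colmx_mulDl colmx_mulDr.

Lemma addmxE (m n : colmx) i k : (m + n) i k = m i k + n i k.
Proof. by []. Qed.

Lemma mulmx_relP m n (p : mx I A) : mxmul_rel m n p <-> p = (m * n : colmx).
Proof. exact: mxmul_relP. Qed.

Lemma mulmx_monE m sg c i k : (m * monmx sg c) i k = m i (sg k) * c k.
Proof. exact: mul_monmxr. Qed.

Lemma mul_scalmxE c m i k : (scalmx c * m) i k = c * m i k.
Proof. exact: mul_scalmxl. Qed.

Lemma monmxM sg tu c d :
  monmx sg c * monmx tu d = monmx (sg \o tu) (fun k => c (tu k) * d k).
Proof.
apply: colmxP => i k; rewrite mulmx_monE /=.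
by case: asboolP => // _; rewrite mul0r.
Qed.

Lemma scalmx1 : scalmx 1 = 1.
Proof. by []. Qed.

Lemma scalmx_mor : ring_mor scalmx.
Proof.
split; [|split]=> // a b; last by rewrite monmxM.
by apply: colmxP => i k; rewrite addmxE /=; case: asboolP => // _; rewrite addr0.
Qed.

Lemma mx_scalP c (m : mx I A) : mx_scal c m <-> m = scalmx c.
Proof.
split=> [h|->]; last by move=> i j /=; case: asboolP.
apply: funext => i; apply: funext => j /=; have [h1 h2] := h i j.
by case: asboolP.
Qed.

(** Commuting with the matrix [E a b c], whose only possibly nonzero entry is [c] at [(a, b)],
    forces [z] to be diagonal with equal central entries; the scalar is read off at [i0]. *)
Lemma colmx_center (i0 : I) (z : colmx) :
  (forall m, z * m = m * z) <-> exists2 c, (forall b, c * b = b * c) & z = scalmx c.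
Proof.
split=> [cz|[c cc ->] m]; last first.
  by apply: colmxP => i k; rewrite mul_scalmxE mulmx_monE.
pose E a b c := monmx (fun=> a) (fun j => if `[< j = b >] then c else 0).
have zE a b c i : z i a * c = if `[< i = a >] then c * z b b else 0.
  have /(congr1 (fun m : colmx => m i b)) := cz (E a b c).
  rewrite mulmx_monE asboolT // => ->.
  rewrite [LHS](colmx_mul_single b) /=; last first.
    move=> j /asboolPn /negbTE ->; case: asboolP => _; exact: mul0r.
  by rewrite [`[< b = b >]]asboolT //; case: asboolP => // _; rewrite mul0r.
exists (z i0 i0) => [b|]; first by rewrite (zE i0 i0) asboolT.
apply: colmxP => i j; rewrite -[z i j]mulr1 (zE j i0) mul1r /=.
by case: asboolP => // _.
Qed.

(* The test for zero makes this column-finite for every function [f]. *)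
Definition colmx_map (f : A -> A) m : colmx.
Proof.
exists (fun i j => if m i j == 0 then 0 else f (m i j)).
apply: (colfin_le _ (colsupp m)) => i k.
by case: eqP => // h _; exact: In_colsupp.
Defined.

Section Map.
Variables (f : A -> A) (fa : ring_aut f).

Lemma colmx_mapE m i k : colmx_map f m i k = f (m i k).
Proof. by rewrite /=; case: eqP => // ->; rewrite ring_aut0. Qed.

Lemma colmx_map_mon sg c : colmx_map f (monmx sg c) = monmx sg (f \o c).
Proof.
apply: colmxP => i k; rewrite colmx_mapE /=.
by case: asboolP => // _; rewrite ring_aut0.
Qed.

End Map.

Lemma colmx_map_comp f g : ring_aut f -> ring_aut g ->
  colmx_map f \o colmx_map g = colmx_map (f \o g).
Proof.
move=> fa ga; apply: funext => m; apply: colmxP => i k.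
rewrite -[LHS]/(colmx_map f (colmx_map g m) i k) !colmx_mapE //.
exact: ring_aut_comp.
Qed.

Lemma colmx_map_id : colmx_map id = id.
Proof. by apply: funext => m; apply: colmxP => i k; rewrite /=; case: eqP. Qed.

Lemma colmx_map_aut f : ring_aut f -> ring_aut (colmx_map f).
Proof.
move=> fa; have [fD [fM [f1 [g fK gK]]]] := fa.
have ga := ring_aut_inv _ _ _ fK gK fa.
split; [move=> m n|split; [move=> m n|split]].
- by apply: colmxP => i k; rewrite addmxE !colmx_mapE // addmxE fD.
- apply: colmxP => i k; rewrite colmx_mapE // [RHS](colmx_mulE _ _ _ _ (colsupp n k)).
  + rewrite (big_morph f fD (ring_aut0 _ _ fa)); apply: eq_bigr => j _.
    by rewrite fM !colmx_mapE.
  + exact: NoDup_colsupp.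
  + move=> j h; apply: In_colsupp => e; apply: h.
    by rewrite colmx_mapE // e ring_aut0.
- by rewrite -scalmx1 colmx_map_mon //; congr monmx; apply: funext => j /=.
- exists (colmx_map g) => m; rewrite -[LHS]/((_ \o _) m) colmx_map_comp //.
  + by have -> : g \o f = id; [apply: funext|rewrite colmx_map_id].
  + by have -> : f \o g = id; [apply: funext|rewrite colmx_map_id].
Qed.

Lemma colmx_map_inner f g : ring_aut f -> ring_aut g -> inner_equiv f g ->
  inner_equiv (colmx_map f) (colmx_map g).
Proof.
move=> fa ga [u [v [uv [vu e]]]]; have [_ [sM _]] := scalmx_mor.
exists (scalmx u), (scalmx v); rewrite -!sM uv vu; split=> //; split=> // m.
by apply: colmxP => i k; rewrite mulmx_monE mul_scalmxE !colmx_mapE.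
Qed.

(** [mx_lift] and [mx_restr] pass between automorphisms of the ring [colmx] and maps of raw
    matrices. The identity is the default value on matrices that are not column-finite, where
    [mx_aut] makes no demand. *)
Definition mx_lift (T : colmx -> colmx) (m : mx I A) : mx I A :=
  if pselect (colfin m) is left h then T (ColMx m h) else m.

Lemma mx_liftE T m : mx_lift T m = T m.
Proof.
rewrite /mx_lift; case: pselect => [h|]; last by case: m.
by congr (cmval (T _)); apply: colmxP.
Qed.

Lemma mx_lift_aut T : ring_aut T -> mx_aut (mx_lift T).
Proof.
move=> Ta; have [TD [TM [T1 [U TK UK]]]] := Ta; split; [|split; [|split; [|split]]].
- by move=> m hm; rewrite (mx_liftE T (ColMx m hm)); exact: cmvalP.
- move=> m n hm hn; pose m' := ColMx m hm; pose n' := ColMx n hn.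
  rewrite -[mxadd _ _]/(cmval (m' + n')) (mx_liftE T m') (mx_liftE T n') mx_liftE.
  by rewrite TD.
- move=> m n p hm hn; pose m' := ColMx m hm; pose n' := ColMx n hn.
  move=> /(mulmx_relP m' n') ->.
  by rewrite (mx_liftE T m') (mx_liftE T n') mx_liftE TM; apply/mulmx_relP.
- by move=> e /mx_scalP ->; apply/mx_scalP; rewrite mx_liftE scalmx1 T1.
exists (mx_lift U) => m hm; pose m' := ColMx m hm.
rewrite (mx_liftE T m') (mx_liftE U m') !mx_liftE TK UK.
by split=> //; exact: cmvalP.
Qed.

Lemma mx_lift_inner T f : ring_aut f -> inner_equiv T (colmx_map f) ->
  mx_inner_equiv (mx_lift T) (mx_map f).
Proof.
move=> fa [u [v [uv [vu e]]]]; exists u, v.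
split; [exact: cmvalP|split; [exact: cmvalP|split]].
  by move=> m /mx_scalP ->; split; apply/mulmx_relP; rewrite ?uv ?vu scalmx1.
move=> m hm; pose m' := ColMx m hm; exists (u * colmx_map f m').
have -> : mx_map f m = colmx_map f m'.
  by apply: funext => i; apply: funext => k; rewrite colmx_mapE.
split; first exact/mulmx_relP.
by rewrite (mx_liftE T m') e; apply/mulmx_relP.
Qed.

Definition mx_restr (F : mx I A -> mx I A) (Fa : mx_aut F) m : colmx :=
  ColMx (F m) (proj1 Fa m (cmvalP m)).

Lemma mx_restr_aut F (Fa : mx_aut F) : ring_aut (mx_restr F Fa).
Proof.
have [Fc [FD [FM [F1 [G FG]]]]] := Fa; split; [move=> m n|split; [move=> m n|split]].
- apply: colmxP => i k; rewrite -[LHS]/(F (mxadd m n) i k).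
  by rewrite (FD m n (cmvalP m) (cmvalP n)).
- have h : mxmul_rel (F m) (F n) (F (m * n)).
    by apply: FM; [exact: cmvalP|exact: cmvalP|exact/mulmx_relP].
  have /mulmx_relP e : mxmul_rel (mx_restr F Fa m) (mx_restr F Fa n) (F (m * n)) by [].
  by apply: colmxP => i k; rewrite -e.
- have /F1 /mx_scalP e : mx_isone (1 : colmx) by apply/mx_scalP.
  by apply: colmxP => i k; rewrite /= e.
have Gc m : colfin (G m) by case: (FG m (cmvalP m)).
exists (fun m => ColMx (G m) (Gc m)) => m; apply: colmxP => i k /=.
  by have [_ [-> _]] := FG m (cmvalP m).
by have [_ [_ ->]] := FG m (cmvalP m).
Qed.

Lemma mx_restr_inner F (Fa : mx_aut F) f : ring_aut f ->
  mx_inner_equiv F (mx_map f) -> inner_equiv (mx_restr F Fa) (colmx_map f).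
Proof.
move=> fa [u [v [hu [hv [e1 e2]]]]]; pose u' := ColMx u hu; pose v' := ColMx v hv.
have /e1[/(mulmx_relP u' v') uv /(mulmx_relP v' u') vu] : mx_isone (1 : colmx).
  exact/mx_scalP.
exists u', v'; split; first by apply: colmxP => i k; rewrite -uv.
split; first by apply: colmxP => i k; rewrite -vu.
move=> m; have [t [h1 h2]] := e2 m (cmvalP m).
have e : mx_map f m = colmx_map f m.
  by apply: funext => i; apply: funext => k; rewrite colmx_mapE.
rewrite e in h1; move/(mulmx_relP u' (colmx_map f m)): h1 => h1.
rewrite h1 in h2; move/(mulmx_relP (u' * colmx_map f m) v'): h2 => h2.
by apply: colmxP => i k; rewrite -h2.
Qed.

End ColumnFiniteMatrices.

(** * Equivariance of the matrix algebra *)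

Section MatrixTeichmuller.
Variables (Q : Type) (qmul : Q -> Q -> Q) (q1 : Q).
Hypothesis HQ : is_grp (full_grp qmul q1).
Variables (S : comPzRingType) (kappa : Q -> S -> S).
Hypothesis Hkappa : ring_action Q qmul q1 S kappa.
Variables (A : pzRingType) (iota : S -> A) (s : Q -> A -> A).
Hypothesis HA : central_alg S A iota.
Hypothesis Hs : qnormal Q qmul S A iota kappa s.

Local Notation R := (colmx Q A).
Local Notation iotaR := (fun x => scalmx Q A (iota x)).
Local Notation sR := (fun q => colmx_map Q A (s q)).

(** * The matrix ring as a [Q]-normal algebra and its Teichmueller complex *)

Lemma colmx_central : central_alg S R iotaR.
Proof.
have [[iD [iM i1]] [iI iZ]] := HA.
have [sD [sM s1]] := scalmx_mor Q A.
split; first by split=> [a b|]; [rewrite iD sD|split=> [a b|];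
  [rewrite iM sM|rewrite i1]].
split.
  move=> x y /(congr1 (fun m : R => m q1 q1)) /=.
  by rewrite asboolT // => /iI.
move=> z; apply: (iff_trans (colmx_center Q A q1 z)).
split=> [[c /iZ [x ->] ->]|[x ->]]; first by exists x.
by exists (iota x) => //; apply/iZ; exists x.
Qed.

Lemma colmx_qnormal : qnormal Q qmul S R iotaR kappa sR.
Proof.
have [sa [sM sk]] := Hs.
split; first by move=> q; exact: colmx_map_aut.
split=> [q r|q x].
  rewrite colmx_map_comp //; apply: colmx_map_inner => //; exact: ring_aut_comp.
by rewrite colmx_map_mon //; congr monmx; apply: funext => j /=.
Qed.

(** Conjugation by the scalar matrix of [u] is conjugation by [u] applied entrywise, so scalar
    matrices and entrywise automorphisms are compatible with the boundaries. *)
Lemma teich_colmx_mor :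
  xmor (teich Q qmul q1 S A iota s) (teich Q qmul q1 S R iotaR sR).
Proof.
have [sa _] := Hs; have [_ [sM s1]] := scalmx_mor Q A.
exists (fun u => (scalmx Q A u.1, scalmx Q A u.2)), (fun g => (colmx_map Q A g.1, g.2)).
split.
  by split=> [[u v] [/= uv vu]|[u v] [u' v'] _ _] /=; rewrite -!sM ?uv ?vu.
split.
  split=> [[f q] [/= fa fq]|[f q] [g r] [/= fa _] [/= ga _]] /=.
    by split; [exact: colmx_map_aut|exact: colmx_map_inner].
  by rewrite colmx_map_comp.
split; first by [].
split; first by [].
split.
  move=> [u v] [/= uv vu]; congr (_, _); apply: funext => m; apply: colmxP => i k.
  rewrite mulmx_monE mul_scalmxE colmx_mapE //; exact: ring_aut_conj.
move=> [f q] [u v] [/= fa _] _ /=.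
by rewrite !colmx_map_mon.
Qed.

(** The map [q |-> (tau q, q)] is a homomorphic section of the Teichmueller complex of the matrix
    ring. Centrality of [S] gives compatibility with the trivial boundary, and the values of [tau]
    on scalars give compatibility with the actions. *)
Lemma xtriv_colmx_mor : sigmaI_equivariant Q qmul q1 S A iota kappa s ->
  xmor (xtriv (unit_grp S) (full_grp qmul q1) (unit_act Q S kappa))
       (teich Q qmul q1 S R iotaR sR).
Proof.
move=> [tau [ta [tM [t1 [tk ti]]]]].
have [[iD [iM i1]] [iI iZ]] := colmx_central; have [sa _] := Hs.
exists (fun x => (iotaR x.1, iotaR x.2)), (fun q => (mx_restr Q A (tau q) (ta q), q)).
split.
  by split=> [[x y] [/= xy yx]|[x y] [x' y'] _ _] /=; rewrite -!iM ?xy ?yx ?i1.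
split.
  split=> [q _|q r _ _] /=.
    by split; [exact: mx_restr_aut|exact: mx_restr_inner].
  congr (_, _); apply: funext => m; apply: colmxP => i k /=.
  by rewrite tM //; exact: cmvalP.
split; first by [].
split; first by [].
split.
  move=> [x y] [/= xy yx]; congr (_, _); apply: funext => m.
  have [_ cx] := iZ (iotaR x).
  rewrite cx -?mulrA -?iM ?xy ?i1 ?mulr1; try by exists x.
  by apply: colmxP => i k /=; rewrite t1 //; exact: cmvalP.
move=> q [x y] _ _ /=.
have h z : iotaR (kappa q z) = mx_restr Q A (tau q) (ta q) (iotaR z).
  have /tk /mx_scalP e : mx_scal (iota z) (iotaR z) by apply/mx_scalP.
  by apply: colmxP => i k; rewrite /= e.
by rewrite -!h.
Qed.

Lemma equivariant_teich_class_zero :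
  sigmaI_equivariant Q qmul q1 S A iota kappa s ->
  teich_class_zero Q qmul q1 S A iota kappa s.
Proof.
move=> Heq.
have hR := teich_xext Q qmul q1 HQ S kappa Hkappa R iotaR sR colmx_central colmx_qnormal.
apply: (rst_trans _ _ _ (teich Q qmul q1 S R iotaR sR)).
  apply: rst_step; split; [|split=> //]; first exact: teich_xext.
  exact: teich_colmx_mor.
apply: rst_sym; apply: rst_step; split; [|split=> //]; first exact: xtriv_xext.
exact: xtriv_colmx_mor.
Qed.

(* The matrices [U q] and [V q] below are the left regular representation of
   [Q] twisted by the cochain [f]: the cocycle identity is what makes
   [U q * g_q (U r) = U (q r) * f (q, r)^-1]. *)
Lemma split_data_equivariant :
  has_split_data (unit_grp S) Q qmul q1 (teich Q qmul q1 S A iota s) ->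
  sigmaI_equivariant Q qmul q1 S A iota kappa s.
Proof.
move=> [g0 [f [gm [gp [fm [gg cc]]]]]].
have [sa [sM sk]] := Hs; have [[iD [iM i1]] [iI iZ]] := HA.
pose g q := (g0 q).1.
have ga q : ring_aut (g q) by case: (gm q).
have gs q : inner_equiv (g q) (s q) by have [_] := gm q; have /= -> := gp q.
have fV q r : (f q r).1 * (f q r).2 = 1 by case: (fm q r).
have Vf q r : (f q r).2 * (f q r).1 = 1 by case: (fm q r).
have gM q r a : g q (g r a) = (f q r).1 * g (qmul q r) a * (f q r).2.
  by have /(congr1 (fun p => p.1 a)) := gg q r.
(* Units are pairs of mutually inverse elements, so the cocycle identity yields a relation for [f]
   and the reversed one for its inverses. *)
have c1 q r t : g q (f r t).1 * (f q (qmul r t)).1 = (f q r).1 * (f (qmul q r) t).1.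
  by have /(congr1 fst) := cc q r t.
have c2 q r t : (f q (qmul r t)).2 * g q (f r t).2 = (f (qmul q r) t).2 * (f q r).2.
  by have /(congr1 snd) := cc q r t.
have [qi hqi] := choice (fun q => gmulVex _ HQ q Logic.I).
have mulqV q : qmul q (qi q) = q1 by case: (hqi q) => _ [].
have mulVq q : qmul (qi q) q = q1 by case: (hqi q) => _ [].
have QA := full_grpA Q qmul q1 HQ; have Q1 := full_grp1 Q qmul q1 HQ.
have KV q x : qmul q (qmul (qi q) x) = x by rewrite QA mulqV Q1.
have VK q x : qmul (qi q) (qmul q x) = x by rewrite QA mulVq Q1.
pose U q : R := monmx Q A (qmul q) (fun t => (f q t).2).
(* The inverse of [U q]: with [x = qt], its entry at [(t, qt)] is [f(q, t)]. *)
pose V q : R := monmx Q A (qmul (qi q)) (fun x => (f q (qmul (qi q) x)).1).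
have monmx1 sg c : sg = id -> c = (fun=> 1) -> monmx Q A sg c = 1.
  by move=> -> ->.
have UV q : U q * V q = 1.
  by rewrite monmxM; apply: monmx1; apply: funext => x /=; rewrite ?KV ?Vf.
have VU q : V q * U q = 1.
  by rewrite monmxM; apply: monmx1; apply: funext => x /=; rewrite ?VK ?fV.
pose G q := colmx_map Q A (g q).
have Ga q : ring_aut (G q) by exact: colmx_map_aut.
have UU q r : U q * G q (U r) = U (qmul q r) * scalmx Q A (f q r).2.
  rewrite /G colmx_map_mon // !monmxM; congr monmx; apply: funext => t /=.
    by rewrite QA.
  exact: c2.
have VV q r : G q (V r) * V q = scalmx Q A (f q r).1 * V (qmul q r).
  have e x : qmul (qi r) (qmul (qi q) x) = qmul (qi (qmul q r)) x.
    by rewrite -[LHS](VK (qmul q r)) -QA !KV.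
  rewrite /G colmx_map_mon // !monmxM; congr monmx; apply: funext => x /=.
    exact: e.
  by rewrite -e -c1 KV.
have GG q r m : G q (G r m) =
    scalmx Q A (f q r).1 * G (qmul q r) m * scalmx Q A (f q r).2.
  by apply: colmxP => i k; rewrite mulmx_monE mul_scalmxE !colmx_mapE.
pose T q m := U q * G q m * V q.
have Ta q : ring_aut (T q).
  exact: (ring_aut_comp _ _ _ (ring_aut_conj _ _ _ (UV q) (VU q)) (Ga q)).
have scV q r : scalmx Q A (f q r).2 * scalmx Q A (f q r).1 = 1.
  by rewrite monmxM; apply: monmx1 => //; apply: funext => x; rewrite Vf.
(* The scalars [f(q, r)] and their inverses from [GG] cancel against those from [UU] and [VV]. *)
have TM q r m : T (qmul q r) m = T q (T r m).
  have [_ [GM _]] := Ga q.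
  rewrite /T !GM GG -!mulrA VV !mulrA UU.
  rewrite -!mulrA [scalmx _ _ _.2 * (scalmx _ _ _ * _)]mulrA scV mul1r.
  by rewrite [scalmx _ _ _.2 * (scalmx _ _ _ * _)]mulrA scV mul1r.
(* [T q1] is idempotent by [TM] and injective, hence the identity. *)
have T1 m : T q1 m = m.
  have [_ [_ [_ /bij_inj inj]]] := Ta q1.
  by apply: inj; rewrite -TM Q1.
have Ti q : inner_equiv (T q) (colmx_map Q A (s q)).
  apply: (@inner_equiv_trans _ _ (G q)); first by exists (U q), (V q).
  exact: colmx_map_inner.
(* [T q] and the entrywise [s q] differ by an inner automorphism, which fixes the central
   scalars. *)
have Tk q x : T q (iotaR x) = iotaR (kappa q x).
  have [u [v [uv [vu ->]]]] := Ti q.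
  have [_ [_ ->]] := colmx_qnormal.
  have [_ [_ /(_ (iotaR (kappa q x))) [_ c]]] := colmx_central.
  by rewrite -c -?mulrA ?uv ?mulr1 //; exists (kappa q x).
exists (fun q => mx_lift Q A (T q)).
split; first by move=> q; exact: mx_lift_aut.
split; first by move=> q r m hm; rewrite !(mx_liftE Q A _ (ColMx Q A m hm)) mx_liftE TM.
split; first by move=> m hm; rewrite (mx_liftE Q A _ (ColMx Q A m hm)) T1.
split; first by move=> q x m /mx_scalP ->; apply/mx_scalP; rewrite mx_liftE Tk.
by move=> q; exact: mx_lift_inner.
Qed.

End MatrixTeichmuller.

Theorem theorem1p6p1 (Q : Type) (qmul : Q -> Q -> Q) (q1 : Q)
  (HQ : is_grp (full_grp qmul q1))
  (S : comPzRingType) (kappa : Q -> S -> S)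
  (Hkappa : ring_action Q qmul q1 S kappa)
  (A : pzRingType) (iota : S -> A) (HA : central_alg S A iota)
  (s : Q -> A -> A) (Hs : qnormal Q qmul S A iota kappa s) :
  teich_class_zero Q qmul q1 S A iota kappa s <->
  sigmaI_equivariant Q qmul q1 S A iota kappa s.
Proof.
split; last exact: equivariant_teich_class_zero.
move=> h; apply: split_data_equivariant => //.
apply/(xequiv_split_data _ _ _ _ (unit_grpP S) HQ _ _ _ h).
apply: xtriv_split_data => //; first exact: unit_grpP.
exact: xtriv_xext.
Qed.
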